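(* Let $G_1$ and $G_2$ be two disjoint connected graphs and let $x_i,y_i\in V(G_i)$ for $i\in\{1,2\}$. Let $C(G_1,G_2)$ be the chain of the graphs $G_1,G_2$ with respect to the vertices $x_1,y_1,x_2,y_2$, i.e. the graph obtained from the disjoint union of $G_1$ and $G_2$ by identifying the vertex $y_1$ with the vertex $x_2$. Then $$\gamma_{sp}(G_1)+\gamma_{sp}(G_2)-1\leq \gamma_{sp}(C(G_1,G_2))\leq \gamma_{sp}(G_1)+\gamma_{sp}(G_2).$$
   Context: All graphs are finite, simple and undirected. $N(v)$ denotes the open neighbourhood of $v$. For a graph $G=(V,E)$ and $S\subseteq V$ write $\overline{S}=V\setminus S$. A set $S\subseteq V$ is dominating if every vertex of $\overline{S}$ is adjacent to at least one vertex of $S$. A dominating set $S$ is a super dominating set of $G$ if for every $u\in\overline{S}$ there exists $w\in S$ with $N(w)\cap\overline{S}=\{u\}$. The super domination number $\gamma_{sp}(G)$ is the minimum cardinality of a super dominating set of $G$. *)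

(* Defs.v *)
From mathcomp Require Import all_boot.

Set Implicit Arguments.
Unset Strict Implicit.
Unset Printing Implicit Defensive.

Record sgraph := SGraph {
  vertex :> finType;
  adj : rel vertex;
  adj_sym : symmetric adj;
  adj_irr : irreflexive adj }.

Definition connected_graph (G : sgraph) : Prop :=
  forall u v : G, connect (@adj G) u v.

Definition nbhd (G : sgraph) (v : G) : {set G} := [set u | adj v u].

Definition dominating (G : sgraph) (S : {set G}) : bool :=
  [forall v in ~: S, exists u in S, adj v u].

Definition super_dominating (G : sgraph) (S : {set G}) : bool :=
  dominating S &&
  [forall u in ~: S, exists w in S, nbhd w :&: ~: S == [set u]].

Lemma super_dominating_setT (G : sgraph) : super_dominating [set: G].
Proof. by apply/andP; split; apply/forall_inP => u; rewrite !inE. Qed.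

(* The starting point setT satisfies super_dominating (lemma above), so the
   minimum ranges over exactly the super dominating sets. *)
Definition gamma_sp (G : sgraph) : nat :=
  #|[arg min_(S < [set: G] | super_dominating S) #|S| ]|.

Section DisjointUnion.
Variables G1 G2 : sgraph.

Definition dunion_adj : rel (G1 + G2)%type := fun u v =>
  match u, v with
  | inl u1, inl v1 => adj u1 v1
  | inr u2, inr v2 => adj u2 v2
  | _, _ => false
  end.

Lemma dunion_sym : symmetric dunion_adj.
Proof. by move=> [u|u] [v|v] //=; apply: adj_sym. Qed.

Lemma dunion_irr : irreflexive dunion_adj.
Proof. by move=> [u|u] /=; apply: adj_irr. Qed.

Definition dunion : sgraph := SGraph dunion_sym dunion_irr.

End DisjointUnion.

Section Identify.
Variables (G : sgraph) (a b : G).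

(* The projection of the quotient by the identification of a and b: the class
   {a, b} is represented by a, every other class by its only element. *)
Definition merge (v : G) : G := if v == b then a else v.

Definition identify_vertex : finType := {v : G | v \in codom merge}.

(* Two distinct classes are adjacent when some representatives are; the
   condition u != v discards the loop that arises when a and b are adjacent. *)
Definition identify_adj : rel identify_vertex := fun u v =>
  (u != v) &&
  [exists u', exists v',
     [&& merge u' == val u, merge v' == val v & adj u' v']].

Lemma identify_sym : symmetric identify_adj.
Proof.
move=> u v; rewrite /identify_adj eq_sym; congr (_ && _).
by apply/existsP/existsP => -[x /existsP[y /and3P[xP yP xy]]];
   exists y; apply/existsP; exists x; rewrite xP yP adj_sym.
Qed.

Lemma identify_irr : irreflexive identify_adj.
Proof. by move=> u; rewrite /identify_adj eqxx. Qed.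

Definition identify : sgraph := SGraph identify_sym identify_irr.

End Identify.

(* As in the chain of arbitrarily many graphs, each graph carries an entry
   vertex x_i and an exit vertex y_i; with two graphs only y1 and x2 are glued,
   so x1 and y2 do not affect the result. *)
Definition chain (G1 G2 : sgraph) (x1 y1 : G1) (x2 y2 : G2) : sgraph :=
  @identify (dunion G1 G2) (inl y1) (inr x2).

(* Main.v *)
(* Write alpha(G) = |V(G)| - gamma_sp(G); it is the largest size of a "packed"
   set T, one in which every u has a private neighbour outside T.  As the chain
   has |V(G1)| + |V(G2)| - 1 vertices, the theorem reads
   alpha(G1) + alpha(G2) - 1 <= alpha(C) <= alpha(G1) + alpha(G2).
   For the upper bound, split a packed set of C along the cut vertex z, leaving
   z on the side that contains its private neighbour.  For the lower bound, note
   that exchanging the members of a packed set with their private neighbours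
   gives a packed set of the same size, so maximum packed sets of G1 and G2 may
   be chosen to avoid y1 and x2.  Their union is packed in C, unless y1 or x2 is
   the private neighbour of some vertex; deleting one such vertex suffices. *)
Require Import Defs.
From mathcomp Require Import all_boot.

Set Implicit Arguments.
Unset Strict Implicit.
Unset Printing Implicit Defensive.

(** * Packed sets and super dominating sets *)

Definition private_nbr (G : sgraph) (T : {set G}) (w u : G) : Prop :=
  w \notin T /\ {in T, forall v, adj w v = (v == u)}.

Definition packed (G : sgraph) (T : {set G}) : Prop :=
  forall u, u \in T -> exists w, private_nbr T w u.

Lemma packedS (G : sgraph) (T' T : {set G}) :
  T' \subset T -> packed T -> packed T'.
Proof.
move=> /subsetP sT pT u /sT /pT [w [wT wE]]; exists w; split.
  by apply: contra wT; apply: sT.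
by move=> v /sT; apply: wE.
Qed.

Lemma super_dominatingP (G : sgraph) (S : {set G}) :
  super_dominating S <-> packed (~: S).
Proof.
split=> [/andP[_ /forall_inP sS] u /sS /exists_inP[w wS /eqP/setP wE]|pS].
  exists w; split=> [|v vS]; first by rewrite inE negbK.
  by have := wE v; rewrite in_setI vS andbT !inE.
have wit u : u \in ~: S ->
    exists w, [/\ w \in S, adj w u & nbhd w :&: ~: S == [set u]].
  move=> uS; have [w [wS wE]] := pS u uS; exists w.
  split; [by rewrite inE negbK in wS | by rewrite wE ?eqxx |].
  apply/eqP/setP=> v; rewrite in_setI !in_set1 inE.
  case: (boolP (v \in ~: S)) => [/wE->|vS]; rewrite ?andbT // andbF.
  by apply/esym; apply: contraNF vS => /eqP->.
by apply/andP; split; apply/forall_inP=> u /wit[w [wS wu wE]];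
  apply/exists_inP; exists w; rewrite // adj_sym.
Qed.

Lemma packed_leq (G : sgraph) (T : {set G}) :
  packed T -> gamma_sp G + #|T| <= #|G|.
Proof.
move=> pT; rewrite addnC -(cardsC T) leq_add2l /gamma_sp.
case: arg_minnP => [|S _ minS]; first exact: super_dominating_setT.
by apply: minS; apply/super_dominatingP; rewrite setCK.
Qed.

Lemma packed_max (G : sgraph) :
  exists T : {set G}, packed T /\ gamma_sp G + #|T| = #|G|.
Proof.
rewrite /gamma_sp; case: arg_minnP => [|S sS _].
  exact: super_dominating_setT.
by exists (~: S); rewrite cardsC; split=> //; apply/super_dominatingP.
Qed.

(** Between [T] and the chosen private neighbours the only edges are those of a perfect matching.
    This is symmetric in the two sides, and the sides are disjoint, so one of them misses [y]. *)
Lemma packed_avoid (G : sgraph) (y : G) (T : {set G}) :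
  packed T -> exists T', [/\ packed T', y \notin T' & #|T'| = #|T|].
Proof.
move=> pT; have [yT|yT] := boolP (y \in T); last by exists T.
have /fin_all_exists[f fP] u : exists w, u \in T -> private_nbr T w u.
  (* Outside [T] the value of [f] is arbitrary; [u] is a default. *)
  by have [/pT[w]|] := boolP (u \in T); [exists w | exists u].
have fT u : u \in T -> f u \notin T by case/fP.
have fE u v : u \in T -> v \in T -> adj (f u) v = (v == u).
  by move=> /fP[_]; apply.
have f_inj : {in T &, injective f}.
  by move=> u v uT vT fuv; apply/eqP; rewrite -fE // -fuv fE.
have Tf u : u \in T -> u \notin f @: T.
  by move=> uT; apply/imsetP=> -[v vT uv]; have := fT v vT; rewrite -uv uT.
exists (f @: T); split; [|exact: Tf|exact: card_in_imset].
move=> _ /imsetP[u uT ->]; exists u; split; first exact: Tf.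
by move=> _ /imsetP[v vT ->]; rewrite adj_sym fE // (inj_in_eq f_inj) // eq_sym.
Qed.

(** * Gluing two graphs at a vertex *)

(** Interface hiding the quotient. It treats both sides alike, so that [gluing_sym] turns a
    statement about [G1] into one about [G2]. *)
Record gluing (G1 G2 C : sgraph) (y : G1) (x : G2)
    (i1 : G1 -> C) (i2 : G2 -> C) : Prop := Gluing {
  gluing_inj1 : injective i1;
  gluing_inj2 : injective i2;
  gluing_eq : forall a b, (i1 a == i2 b) = (a == y) && (b == x);
  gluing_cover : forall c, (exists a, c = i1 a) \/ (exists b, c = i2 b);
  gluing_adj1 : forall a a', adj (i1 a) (i1 a') = adj a a';
  gluing_adj2 : forall b b', adj (i2 b) (i2 b') = adj b b';
  gluing_adj12 : forall a b,
    adj (i1 a) (i2 b) = (a == y) && adj x b || (b == x) && adj y a }.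

Lemma gluing_sym (G1 G2 C : sgraph) (y : G1) (x : G2) (i1 : G1 -> C)
  (i2 : G2 -> C) : gluing y x i1 i2 -> gluing x y i2 i1.
Proof.
case=> inj1 inj2 eq12 cover adj1 adj2 adj12; split=> //.
- by move=> b a; rewrite eq_sym eq12 andbC.
- by move=> c; case: (cover c); [right | left].
by move=> b a; rewrite adj_sym adj12 orbC.
Qed.

Lemma gluing_point (G1 G2 C : sgraph) (y : G1) (x : G2) (i1 : G1 -> C)
  (i2 : G2 -> C) : gluing y x i1 i2 -> i1 y = i2 x.
Proof. by move=> glue; apply/eqP; rewrite (gluing_eq glue) !eqxx. Qed.

(** Inclusion-exclusion: the two images cover [C] and meet in the glued vertex alone. *)
Lemma gluing_card (G1 G2 C : sgraph) (y : G1) (x : G2) (i1 : G1 -> C)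
  (i2 : G2 -> C) : gluing y x i1 i2 -> #|C| + 1 = #|G1| + #|G2|.
Proof.
move=> glue; rewrite -!cardsT.
rewrite -(card_imset [set: G1] (gluing_inj1 glue)).
rewrite -(card_imset [set: G2] (gluing_inj2 glue)) -cardsUI.
congr (_ + _).
  apply: eq_card => c; rewrite !inE; apply/esym.
  by have [[a ->]|[b ->]] := gluing_cover glue c; rewrite imset_f ?inE ?orbT.
rewrite -(cards1 (i1 y)); apply: eq_card => c; rewrite !inE.
apply/eqP/andP => [->|[/imsetP[a _ ->] /imsetP[b _ /eqP]]].
  by rewrite {2}(gluing_point glue) !imset_f ?inE.
by rewrite (gluing_eq glue) => /andP[/eqP-> _].
Qed.

(** * Splitting a packed set of the glued graph *)

Lemma packed_preimset (G1 G2 C : sgraph) (y : G1) (x : G2) (i1 : G1 -> C)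
    (i2 : G2 -> C) (T : {set C}) :
  gluing y x i1 i2 -> packed T ->
  (i1 y \in T -> exists a, private_nbr T (i1 a) (i1 y)) ->
  packed (i1 @^-1: T).
Proof.
move=> glue pT yw u; rewrite inE => uT.
suff [a [aT aE]] : exists a, private_nbr T (i1 a) (i1 u).
  exists a; split=> [|v]; rewrite inE // => vT.
  by rewrite -(gluing_adj1 glue) aE // (inj_eq (gluing_inj1 glue)).
have [uy|uy] := eqVneq u y; first by rewrite uy in uT *; apply: yw.
have [w wP] := pT _ uT; have [[a wa]|[b wb]] := gluing_cover glue w.
  by exists a; rewrite -wa.
(* A vertex [i2 b] adjacent to [i1 u] with [u] different from [y] must be the glued vertex, which
   also comes from [G1]. *)
exists y; have := wP.2 _ uT.
rewrite wb eqxx (gluing_adj12 (gluing_sym glue)) (negPf uy) orbF.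
by case/andP=> /eqP bx _; rewrite (gluing_point glue) -bx -wb.
Qed.

Lemma gluing_packed_split (G1 G2 C : sgraph) (y : G1) (x : G2) (i1 : G1 -> C)
    (i2 : G2 -> C) (T : {set C}) :
  gluing y x i1 i2 -> packed T ->
  (i1 y \in T -> exists a, private_nbr T (i1 a) (i1 y)) ->
  gamma_sp G1 + gamma_sp G2 + #|T| <= #|G1| + #|G2|.
Proof.
move=> glue pT yw; have p1 := packed_preimset glue pT yw.
(* The glued vertex is counted on the first side only; once it is removed, the side condition of
   [packed_preimset] for [i2] is vacuous. *)
have p2 : packed (i2 @^-1: (T :\ i1 y)).
  apply: packed_preimset (gluing_sym glue) (packedS (subsetDl _ _) pT) _.
  by rewrite (gluing_point glue) !inE eqxx.
apply: leq_trans (leq_add (packed_leq p1) (packed_leq p2)).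
rewrite addnACA leq_add2l.
rewrite -(card_imset _ (gluing_inj1 glue)) -(card_imset _ (gluing_inj2 glue)).
apply: leq_trans (leq_card_setU _ _); apply/subset_leq_card/subsetP=> c cT.
rewrite inE; have [cy|cy] := eqVneq c (i1 y).
  by rewrite cy imset_f // inE -cy.
by have [[a ca]|[b cb]] := gluing_cover glue c; subst c;
  rewrite imset_f ?orbT // !inE ?cy.
Qed.

Lemma gluing_packed_leq (G1 G2 C : sgraph) (y : G1) (x : G2) (i1 : G1 -> C)
    (i2 : G2 -> C) (T : {set C}) :
  gluing y x i1 i2 -> packed T ->
  gamma_sp G1 + gamma_sp G2 + #|T| <= #|G1| + #|G2|.
Proof.
move=> glue pT; have [yT|yT] := boolP (i1 y \in T); last first.
  by apply: gluing_packed_split glue pT _; rewrite (negPf yT).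
have [w wP] := pT _ yT; have [[a wa]|[b wb]] := gluing_cover glue w.
  by apply: gluing_packed_split glue pT _ => _; exists a; rewrite -wa.
rewrite (addnC (gamma_sp G1)) (addnC #|G1|).
apply: gluing_packed_split (gluing_sym glue) pT _ => _.
by exists b; rewrite -wb -(gluing_point glue).
Qed.

(** * Uniting packed sets of the two sides *)

(** Since [T2] avoids [x], the glued vertex is the only one from [G1] that can see [i2 @: T2]. Hence
    privacy can fail only for [w = y], when [x] has a neighbour in [T2]. *)
Lemma private_nbr_glue (G1 G2 C : sgraph) (y : G1) (x : G2) (i1 : G1 -> C)
    (i2 : G2 -> C) (T1 : {set G1}) (T2 : {set G2}) (w u : G1) :
  gluing y x i1 i2 -> y \notin T1 -> x \notin T2 -> u \in T1 ->
  private_nbr T1 w u -> (w = y -> {in T2, forall b, ~~ adj x b}) ->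
  private_nbr (i1 @: T1 :|: i2 @: T2) (i1 w) (i1 u).
Proof.
move=> glue yT xT uT [wT wE] wy.
have i12 a b : b \in T2 -> (i1 a == i2 b) = false.
  move=> bT; rewrite (gluing_eq glue) andbC.
  by case: eqP => // bx; rewrite -bx bT in xT.
split.
  rewrite inE (mem_imset _ _ (gluing_inj1 glue)) (negPf wT) /=.
  by apply/imsetP=> -[b bT /eqP]; rewrite i12.
move=> c; rewrite inE => /orP[] /imsetP[v vT ->].
  by rewrite (gluing_adj1 glue) wE // (inj_eq (gluing_inj1 glue)).
rewrite eq_sym i12 // (gluing_adj12 glue).
have -> : (v == x) = false by apply: contraNF xT => /eqP <-.
by rewrite orbF; case: eqP => // /wy/(_ v vT)/negPf->.
Qed.

Lemma packed_glue (G1 G2 C : sgraph) (y : G1) (x : G2) (i1 : G1 -> C)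
    (i2 : G2 -> C) (T1 : {set G1}) (T2 : {set G2}) :
  gluing y x i1 i2 -> packed T1 -> packed T2 -> y \notin T1 -> x \notin T2 ->
  (forall u, u \in T1 -> private_nbr T1 y u ->
     {in T2, forall b, ~~ adj x b}) ->
  (forall u, u \in T2 -> private_nbr T2 x u ->
     {in T1, forall a, ~~ adj y a}) ->
  packed (i1 @: T1 :|: i2 @: T2).
Proof.
move=> glue p1 p2 yT xT H1 H2 c; rewrite inE => /orP[] /imsetP[u uT ->].
  have [w wP] := p1 u uT; exists (i1 w).
  apply: (private_nbr_glue glue yT xT uT wP) => wy.
  by apply: (H1 _ uT); rewrite -wy.
have [w wP] := p2 u uT; exists (i2 w); rewrite setUC.
apply: (private_nbr_glue (gluing_sym glue) xT yT uT wP) => wx.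
by apply: (H2 _ uT); rewrite -wx.
Qed.

Lemma card_glue (G1 G2 C : sgraph) (y : G1) (x : G2) (i1 : G1 -> C)
    (i2 : G2 -> C) (T1 : {set G1}) (T2 : {set G2}) :
  gluing y x i1 i2 -> y \notin T1 ->
  #|i1 @: T1 :|: i2 @: T2| = #|T1| + #|T2|.
Proof.
move=> glue yT; rewrite cardsU.
rewrite (card_imset _ (gluing_inj1 glue)) (card_imset _ (gluing_inj2 glue)).
suff -> : i1 @: T1 :&: i2 @: T2 = set0 by rewrite cards0 subn0.
apply/setP=> c; rewrite !inE.
apply/andP=> -[/imsetP[a aT ->] /imsetP[b _ /eqP]].
by rewrite (gluing_eq glue) => /andP[/eqP ay _]; rewrite -ay aT in yT.
Qed.

(* If y is the private neighbour of u, it has no neighbour left in T1 :\ u, so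
   it can serve as the private neighbour of a vertex on the other side. *)
Lemma packed_glueD1 (G1 G2 C : sgraph) (y : G1) (x : G2) (i1 : G1 -> C)
    (i2 : G2 -> C) (T1 : {set G1}) (T2 : {set G2}) (u : G1) :
  gluing y x i1 i2 -> packed T1 -> packed T2 -> y \notin T1 -> x \notin T2 ->
  u \in T1 -> private_nbr T1 y u ->
  exists T : {set C}, packed T /\ #|T1| + #|T2| <= #|T| + 1.
Proof.
move=> glue p1 p2 yT xT uT [_ yE].
have yT' : y \notin T1 :\ u by rewrite inE (negPf yT) andbF.
have nadj : {in T1 :\ u, forall a, ~~ adj y a}.
  by move=> a; rewrite !inE => /andP[au aT]; rewrite yE.
exists (i1 @: (T1 :\ u) :|: i2 @: T2); split; last first.
  by rewrite (card_glue _ glue yT') (cardsD1 u T1) uT add1n addSn addn1.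
apply: packed_glue glue (packedS (subsetDl _ _) p1) p2 yT' xT _ _ => // v vT.
by case=> _ /(_ v vT); rewrite eqxx (negPf (nadj v vT)).
Qed.

Lemma gluing_packed_geq (G1 G2 C : sgraph) (y : G1) (x : G2) (i1 : G1 -> C)
    (i2 : G2 -> C) : gluing y x i1 i2 ->
  exists T : {set C},
    packed T /\ #|G1| + #|G2| <= gamma_sp G1 + gamma_sp G2 + #|T| + 1.
Proof.
move=> glue.
have [T1' [/(packed_avoid y)[T1 [p1 yT <-]] <-]] := packed_max G1.
have [T2' [/(packed_avoid x)[T2 [p2 xT <-]] <-]] := packed_max G2.
suff [T [pT leT]] :
    exists T : {set C}, packed T /\ #|T1| + #|T2| <= #|T| + 1.
  by exists T; split=> //; rewrite addnACA -[leqRHS]addnA leq_add2l.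
(* Boolean form of: [z] is the private neighbour of some vertex of [T]. It makes the case
   distinction decidable. *)
pose hit (G : sgraph) (T : {set G}) (z : G) :=
  [exists u in T, [forall v in T, adj z v == (v == u)]].
have hitP (G : sgraph) (T : {set G}) z : z \notin T ->
    reflect (exists2 u, u \in T & private_nbr T z u) (hit G T z).
  move=> zT; apply: (iffP exists_inP) => -[u uT].
    by move/forall_inP=> uE; exists u => //; split=> // v /uE/eqP.
  by case=> _ uE; exists u => //; apply/forall_inP=> v /uE->.
have [[u uT yu]|no1] := hitP _ _ _ yT.
  exact: packed_glueD1 glue p1 p2 yT xT uT yu.
have [[u uT xu]|no2] := hitP _ _ _ xT.
  rewrite addnC.
  exact: packed_glueD1 (gluing_sym glue) p2 p1 xT yT uT xu.
(* Neither [y] nor [x] is a private neighbour here, so both side conditions of [packed_glue] are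
   vacuous and no vertex is lost. *)
exists (i1 @: T1 :|: i2 @: T2); rewrite (card_glue _ glue yT) leq_addr.
split=> //; apply: packed_glue glue p1 p2 yT xT _ _ => u uT zu.
  by case: no1; exists u.
by case: no2; exists u.
Qed.

Lemma gluing_gamma_sp (G1 G2 C : sgraph) (y : G1) (x : G2) (i1 : G1 -> C)
    (i2 : G2 -> C) : gluing y x i1 i2 ->
  gamma_sp G1 + gamma_sp G2 - 1 <= gamma_sp C <= gamma_sp G1 + gamma_sp G2.
Proof.
move=> glue; have cardC := gluing_card glue; apply/andP; split.
  (* An upper bound on packed sets of [C], applied to a maximum one, bounds [gamma_sp C] from
     below. *)
  have [T [pT eT]] := packed_max C.
  have := gluing_packed_leq glue pT.
  by rewrite -cardC -eT [leqRHS]addnAC leq_add2r leq_subLR add1n addn1.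
have [T [pT leT]] := gluing_packed_geq glue.
have := leq_trans (leq_add (packed_leq pT) (leqnn 1)) (eq_leq cardC).
by move=> /leq_trans/(_ leT); rewrite !leq_add2r.
Qed.

(** * The chain as an instance of gluing *)

Definition identify_proj (G : sgraph) (a b v : G) : identify a b :=
  Sub (Defs.merge a b v) (codom_f (Defs.merge a b) v).

Lemma gluing_chain (G1 G2 : sgraph) (x1 y1 : G1) (x2 y2 : G2) :
  @gluing G1 G2 (chain x1 y1 x2 y2) y1 x2
    (fun a => @identify_proj (dunion G1 G2) (inl y1) (inr x2) (inl a))
    (fun b => @identify_proj (dunion G1 G2) (inl y1) (inr x2) (inr b)).
Proof.
set pr := @identify_proj (dunion G1 G2) (inl y1) (inr x2).
have prll a a' : (pr (inl a) == pr (inl a')) = (a == a') by [].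
have val_prr b : val (pr (inr b)) = if b == x2 then inl y1 else inr b by [].
have prlr a b : (pr (inl a) == pr (inr b)) = (a == y1) && (b == x2).
  by rewrite -val_eqE val_prr andbC; case: (b == x2).
have prrr b b' : (pr (inr b) == pr (inr b')) = (b == b').
  rewrite -val_eqE !val_prr.
  have [->|bx] := eqVneq b x2; first by case: (eqVneq b' x2); rewrite ?eqxx.
  by have [->|//] := eqVneq b' x2; rewrite (negPf bx).
(* Fibres of [pr] are singletons, except the glued class, which holds both [inl y1] and [inr x2]. *)
have fibl u a : pr u == pr (inl a) -> u = inl a \/ u = inr x2 /\ a = y1.
  case: u => [a'|b]; first by rewrite prll => /eqP->; left.
  by rewrite eq_sym prlr => /andP[/eqP-> /eqP->]; right.
have fibr u b : pr u == pr (inr b) -> u = inr b \/ u = inl y1 /\ b = x2.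
  case: u => [a|b']; last by rewrite prrr => /eqP->; left.
  by rewrite prlr => /andP[/eqP-> /eqP->]; right.
have adjP u v : reflect
    (pr u != pr v /\
     exists u' v', [/\ pr u' == pr u, pr v' == pr v & adj u' v'])
    (@adj (chain x1 y1 x2 y2) (pr u) (pr v)).
  apply: (iffP andP) => -[uv].
    move=> /existsP[u' /existsP[v' /and3P[uu vv uv']]].
    by split=> //; exists u', v'.
  move=> [u' [v' [uu vv uv']]]; split=> //.
  by apply/existsP; exists u'; apply/existsP; exists v'; apply/and3P.
have adj_neq (G : sgraph) (u v : G) : adj u v -> u != v.
  by apply: contraTneq => ->; rewrite adj_irr.
split.
- by move=> a a' /eqP; rewrite prll => /eqP.
- by move=> b b' /eqP; rewrite prrr => /eqP.
- exact: prlr.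
- move=> c; have /codomP[[a|b] ca] := valP c.
    by left; exists a; apply: val_inj.
  by right; exists b; apply: val_inj.
- move=> a a'; apply/adjP/idP => [[_ [u [v []]]]|aa'].
    (* Mixed representatives are never adjacent in the disjoint union; if both are [inr x2], the
       edge would be a loop. *)
    move=> /fibl[->|[-> ->]] /fibl[->|[-> ->]] //=.
    by rewrite adj_irr.
  by rewrite prll adj_neq //; split=> //; exists (inl a), (inl a').
- move=> b b'; apply/adjP/idP => [[_ [u [v []]]]|bb'].
    move=> /fibr[->|[-> ->]] /fibr[->|[-> ->]] //=.
    by rewrite adj_irr.
  by rewrite prrr adj_neq //; split=> //; exists (inr b), (inr b').
move=> a b; apply/adjP/orP => [[_ [u [v []]]]|[] /andP[/eqP-> xy]].
- move=> /fibl[->|[-> ->]] /fibr[->|[-> ->]] //= uv.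
  + by right; rewrite eqxx adj_sym.
  + by left; rewrite eqxx.
- rewrite prlr eqxx /= eq_sym adj_neq //; split=> //.
  (* The glued class is represented on the side of [G2], where the edge lives. *)
  by exists (inr x2), (inr b); rewrite eq_sym prlr !eqxx.
rewrite prlr eqxx andbT eq_sym adj_neq //; split=> //.
by exists (inl a), (inl y1); rewrite prlr !eqxx /= adj_sym.
Qed.

Theorem theorem3p2 (G1 G2 : sgraph)
  (hG1 : connected_graph G1) (hG2 : connected_graph G2)
  (x1 y1 : G1) (x2 y2 : G2) :
  gamma_sp G1 + gamma_sp G2 - 1 <= gamma_sp (chain x1 y1 x2 y2) /\
  gamma_sp (chain x1 y1 x2 y2) <= gamma_sp G1 + gamma_sp G2.
Proof. by apply/andP; apply: gluing_gamma_sp (gluing_chain x1 y1 x2 y2). Qed.
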